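(* Let $k$ be a field with $u(k)\leq 2$ which is not quadratically closed, with $\mathrm{char}(k)\neq 2$ and $|k|\geq 5$. Let $\mathscr{C}$ be a conjugacy class in $\mathrm{SL}_2(k)$. Then, for $\overline{\epsilon_1}, \overline{\epsilon_2} \in k^{\times}/k^{\times 2}$ with $\overline{\epsilon_1}\neq \overline{\epsilon_2}$, $\mathscr{C}\subseteq U_{\overline{\epsilon_1}}U_{\overline{\epsilon_2}}$ if and only if one of the following holds: (1) $\mathscr{C}$ is a semisimple conjugacy class with $2-\mathrm{tr}(\mathscr{C})\in \epsilon_1\epsilon_2k^{\times 2}$; (2) $\mathscr{C}$ is a unipotent conjugacy class; (3) $\mathscr{C}=\{I\}$, $-1\notin k^{\times 2}$ and $\overline{\epsilon_2}=\overline{-\epsilon_1}$.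
   Context: A field $k$ has $u(k)\leq 2$ if every quadratic form in $3$ variables over $k$ is isotropic. A field is quadratically closed if it admits no quadratic extension. $k^{\times 2}$ is the set of squares in $k^\times$, and $\bar\epsilon$ is the image of $\epsilon\in k^\times$ in $k^\times/k^{\times2}$. $U_{\overline{\epsilon}}$ denotes the $\mathrm{SL}_2(k)$-conjugacy class of $\begin{pmatrix}1&\epsilon\\0&1\end{pmatrix}$, which depends only on $\overline{\epsilon}$. The unipotent conjugacy classes are exactly the $U_{\overline{\epsilon}}$ (so $\{I\}$ is not counted as unipotent). Semisimple classes are non-central. $\mathrm{tr}(\mathscr{C})$ is the common trace of elements of $\mathscr{C}$. $AB=\{xy:x\in A,y\in B\}$. *)

(* Defs.v *)
From HB Require Import structures.
From mathcomp Require Import all_boot all_order all_algebra all_field.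
From mathcomp Require Export mpoly.

Set Implicit Arguments.
Unset Strict Implicit.
Unset Printing Implicit Defensive.

Import GRing.Theory.
Local Open Scope ring_scope.

Section Fields.
Variable k : fieldType.

Definition isotropic (n : nat) (q : {mpoly k[n]}) : Prop :=
  exists2 v : 'I_n -> k, (exists i, v i != 0) & q.@[v] = 0.

(* A quadratic form in n variables is a homogeneous polynomial of degree 2
   (possibly zero or degenerate). *)
Definition u_le2 : Prop :=
  forall q : {mpoly k[3]}, q \is 2.-homog -> isotropic q.

Definition quadratically_closed : Prop :=
  ~ exists L : fieldExtType k, \dim {:L} = 2%N.

Definition unit_square (x : k) : Prop := exists2 z : k, z != 0 & x = z ^+ 2.

(* For nonzero a and b: equality of the images of a and b in k^* / k^*2. *)
Definition same_sqclass (a b : k) : Prop := unit_square (a / b).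

Definition in_sqcoset (a x : k) : Prop :=
  exists2 s : k, unit_square s & x = a * s.

End Fields.

Section SL2.
Variable k : fieldType.

(* Subsets of SL_2(k) are represented as predicates on 2 x 2 matrices. *)
Definition mxpred : Type := 'M[k]_2 -> Prop.

Definition SL2 : mxpred := fun A => \det A = 1.

Definition sl2_class (A : 'M[k]_2) : mxpred :=
  fun B => exists2 g, SL2 g & B = g *m A *m invmx g.

Definition same_mxpred (C D : mxpred) : Prop := forall A, C A <-> D A.

Definition sub_mxpred (C D : mxpred) : Prop := forall A, C A -> D A.

Definition is_class (C : mxpred) : Prop :=
  exists2 A, SL2 A & same_mxpred C (sl2_class A).

Definition mul_mxpred (C D : mxpred) : mxpred :=
  fun Z => exists X Y, [/\ C X, D Y & Z = X *m Y].

Definition Uclass (e : k) : mxpred :=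
  sl2_class (1%:M + e *: delta_mx 0 1).

(* The class {I} is not counted as unipotent. *)
Definition unipotent_class (C : mxpred) : Prop :=
  exists2 e : k, e != 0 & same_mxpred C (Uclass e).

Definition central (A : 'M[k]_2) : Prop :=
  forall g, SL2 g -> g *m A = A *m g.

(* Diagonalizability over some extension field of k is the same as
   diagonalizability over an algebraic closure of k. *)
Definition semisimple (A : 'M[k]_2) : Prop :=
  exists (L : fieldType) (f : {rmorphism k -> L}),
    diagonalizable (map_mx f A).

(* By convention, semisimple classes are non-central. *)
Definition semisimple_class (C : mxpred) : Prop :=
  is_class C /\ forall A, C A -> semisimple A /\ ~ central A.

Definition class_trace (C : mxpred) (t : k) : Prop :=
  (exists A, C A) /\ forall A, C A -> \tr A = t.

End SL2.

(* Main.v *)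
(** Every element of [U_e] has the form [1 + e N] with [N = v (J v)^T], [J] the
    quarter turn and [v] a nonzero vector, and
    [tr ((1 + e1 N_v) (1 + e2 N_w)) = 2 - e1 e2 det (v, w)^2].  If
    [det (v, w) = 0] the product is [1 + (e1 a^2 + e2 b^2) N], which is
    unipotent or the identity.  Conversely, given [A] with
    [2 - tr A = e1 e2 s^2], one looks for [v] with
    [tr ((1 - e1 N_v) A) = 2], that is, [det (v, A v) = - e2 s^2]; this binary
    quadratic form in [v] is nondegenerate when [tr A <> 2, -2], hence
    universal because [u(k) <= 2].  In the unipotent case one represents
    [e] as [e1 a^2 + e2 b^2] with [a] and [b] both nonzero. *)

Require Import Defs.
From mathcomp Require Import all_boot all_order all_algebra all_field ring.
From Stdlib Require Import Classical.

Set Implicit Arguments.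
Unset Strict Implicit.
Unset Printing Implicit Defensive.

Import GRing.Theory.
Local Open Scope ring_scope.

(** * 2 x 2 matrices by entries *)

Section Matrix2.
Variable R : comNzRingType.

(** With this form, [congr mx2] turns a matrix identity into four scalar goals for [ring] or
    [field]. *)
Definition mx2 (a b c d : R) : 'M[R]_2 :=
  \matrix_(i, j) if i == 0 then if j == 0 then a else b
                 else if j == 0 then c else d.

Lemma mx2_eta (A : 'M[R]_2) : A = mx2 (A 0 0) (A 0 1) (A 1 0) (A 1 1).
Proof.
apply/matrixP=> i j; rewrite mxE.
by case: i j => [[|[|//]] ?] [[|[|//]] ?] /=; congr (A _ _); apply/val_inj.
Qed.

Lemma mx2M a b c d a' b' c' d' :
  mx2 a b c d *m mx2 a' b' c' d' =
  mx2 (a * a' + b * c') (a * b' + b * d') (c * a' + d * c') (c * b' + d * d').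
Proof.
by rewrite [LHS]mx2_eta !mxE !big_ord_recl !big_ord0 !mxE /= !addr0.
Qed.

Lemma mx2_scalar a : a%:M = mx2 a 0 0 a.
Proof. by rewrite [LHS]mx2_eta !mxE. Qed.

Lemma tr_mx2 a b c d : \tr (mx2 a b c d) = a + d.
Proof. by rewrite /mxtrace !big_ord_recl big_ord0 !mxE /= addr0. Qed.

Lemma det_mx2 a b c d : \det (mx2 a b c d) = a * d - b * c.
Proof.
rewrite (expand_det_row _ 0) !big_ord_recl big_ord0 /cofactor !det_mx11 !mxE /=.
by rewrite expr0 expr1; ring.
Qed.

Lemma mx2_inj a b c d a' b' c' d' :
  mx2 a b c d = mx2 a' b' c' d' -> [/\ a = a', b = b', c = c' & d = d'].
Proof.
move=> /matrixP E; split.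
- by have := E 0 0; rewrite !mxE.
- by have := E 0 1; rewrite !mxE.
- by have := E 1 0; rewrite !mxE.
- by have := E 1 1; rewrite !mxE.
Qed.

End Matrix2.

(** * Conjugacy in SL_2 and transvections *)

Section SL2Classes.
Variable k : fieldType.
Implicit Types (A B C : 'M[k]_2) (e x y : k).

Lemma SL2_unit {A} : SL2 A -> A \in unitmx.
Proof. by rewrite unitmxE => ->; exact: unitr1. Qed.

Lemma SL2M A B : SL2 A -> SL2 B -> SL2 (A *m B).
Proof. by rewrite /SL2 det_mulmx => -> ->; rewrite mulr1. Qed.

Lemma SL2V A : SL2 A -> SL2 (invmx A).
Proof. by rewrite /SL2 det_inv => ->; rewrite invr1. Qed.

Lemma invmxM_SL2 A B : SL2 A -> SL2 B -> invmx (A *m B) = invmx B *m invmx A.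
Proof.
move=> /SL2_unit uA /SL2_unit uB.
have uAB : A *m B \in unitmx by rewrite unitmx_mul uA.
apply: (can_inj (mulKmx uAB)).
by rewrite mulmxV // mulmxA mulmxK // mulmxV.
Qed.

Lemma sl2_class_refl A : sl2_class A A.
Proof.
exists (1%:M : 'M[k]_2); first by rewrite /SL2 det1.
by rewrite invmx1 mulmx1 mul1mx.
Qed.

Lemma sl2_class_sym A B : sl2_class A B -> sl2_class B A.
Proof.
case=> g gS ->; exists (invmx g); first exact: SL2V.
have ug := SL2_unit gS.
by rewrite invmxK !mulmxA mulVmx // mul1mx mulmxKV.
Qed.

Lemma sl2_class_trans A B C : sl2_class A B -> sl2_class B C -> sl2_class A C.
Proof.
case=> g gS -> [h hS ->]; exists (h *m g); first exact: SL2M.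
by rewrite invmxM_SL2 // !mulmxA.
Qed.

Lemma sl2_class_same A B :
  sl2_class B A -> same_mxpred (sl2_class A) (sl2_class B).
Proof.
move=> BA X; split; first exact: sl2_class_trans.
exact/sl2_class_trans/sl2_class_sym.
Qed.

Lemma sl2_class_tr A B : sl2_class A B -> \tr B = \tr A.
Proof.
by case=> g /SL2_unit ug ->; rewrite -mulmxA mxtrace_mulC mulmxKV.
Qed.

Lemma sl2_class_det A B : sl2_class A B -> \det B = \det A.
Proof.
case=> g gS ->; rewrite !det_mulmx (SL2V gS) (gS : \det g = 1).
by rewrite mul1r mulr1.
Qed.

(* [1 + e v (J v)^T] with [v = (x, y)]. *)
Definition transvection e x y : 'M[k]_2 :=
  mx2 (1 - e * x * y) (e * x ^+ 2) (- (e * y ^+ 2)) (1 + e * x * y).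

Lemma invmx2 (a b c d : k) :
  a * d - b * c = 1 -> invmx (mx2 a b c d) = mx2 d (- b) (- c) a.
Proof.
move=> h; have u : mx2 a b c d \in unitmx.
  by rewrite unitmxE det_mx2 h unitr1.
apply: (can_inj (mulKmx u)); rewrite mulmxV // mx2M mx2_scalar -h.
by congr mx2; ring.
Qed.

(** Conjugating [mx2 1 e 0 1] by [g] involves only the first column of [g], and every nonzero vector
    is the first column of a matrix of determinant 1. *)
Lemma UclassP e A :
  Uclass e A <->
  exists x y, (x != 0) || (y != 0) /\ A = transvection e x y.
Proof.
have E1 : 1%:M + e *: delta_mx 0 1 = mx2 1 e 0 1.
  by rewrite [LHS]mx2_eta !mxE /= !(mulr0, mulr1, addr0, add0r).
have conj a b c d : a * d - b * c = 1 ->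
    mx2 a b c d *m mx2 1 e 0 1 *m invmx (mx2 a b c d) = transvection e a c.
  move=> h; rewrite invmx2 // !mx2M /transvection.
  have {}h : a * d = 1 + b * c by rewrite -h subrK.
  by congr mx2; ring: h.
rewrite /Uclass E1; split.
- case=> g; rewrite [g]mx2_eta; move: (g 0 0) (g 0 1) (g 1 0) (g 1 1).
  move=> a b c d; rewrite /SL2 det_mx2 => h ->; rewrite conj //.
  exists a, c; split=> //; rewrite -negb_and; apply/negP=> /andP[/eqP a0 /eqP c0].
  by move/eqP: h; rewrite a0 c0 mul0r mulr0 subr0 eq_sym oner_eq0.
- case=> x [y [xy ->]].
  have [b [d h]] : exists b d, x * d - b * y = 1.
    have [x0|x0] := eqVneq x 0; last by exists 0, x^-1; rewrite mul0r subr0 divff.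
    by move: xy; rewrite x0 eqxx /= => y0; exists (- y^-1), 0; field.
  exists (mx2 x b y d); first by rewrite /SL2 det_mx2.
  by rewrite conj.
Qed.

Lemma transvectionM e c x y :
  transvection e (c * x) (c * y) = transvection (e * c ^+ 2) x y.
Proof. by rewrite /transvection; congr mx2; ring. Qed.

Lemma transvection_mul e f x y :
  transvection e x y *m transvection f x y = transvection (e + f) x y.
Proof. by rewrite /transvection mx2M; congr mx2; ring. Qed.

Lemma transvection0 x y : transvection 0 x y = 1%:M.
Proof. by rewrite /transvection mx2_scalar; congr mx2; ring. Qed.

Lemma det_transvection e x y : \det (transvection e x y) = 1.
Proof. by rewrite /transvection det_mx2; ring. Qed.

(** The bracket is det (v, A v) for v = (x, y). *)
Lemma tr_transvectionN_mul e x y A :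
  \tr (transvection (- e) x y *m A) =
  \tr A - e * (A 1 0 * x ^+ 2 + (A 1 1 - A 0 0) * x * y + - A 0 1 * y ^+ 2).
Proof.
by rewrite [in LHS](mx2_eta A) [in RHS](mx2_eta A) !mxE /=
           /transvection mx2M !tr_mx2; ring.
Qed.

Lemma tr_transvection_mul e f x y z w :
  \tr (transvection e x y *m transvection f z w) =
  2%:R - e * f * (x * w - y * z) ^+ 2.
Proof. by rewrite /transvection mx2M tr_mx2; ring. Qed.

(** Here A - 1 has trace and determinant 0, so its entries can be read off as those of f v (J v)^T;
    [f = 0] is allowed and gives the identity. *)
Lemma tr2_transvection A :
  \det A = 1 -> \tr A = 2%:R ->
  exists f x y, (x != 0) || (y != 0) /\ A = transvection f x y.
Proof.
rewrite [A]mx2_eta; move: (A 0 0) (A 0 1) (A 1 0) (A 1 1) => a b c d.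
rewrite det_mx2 tr_mx2 => hd ht.
have da : a = 2%:R - d by rewrite -ht addrK.
(* This is det (A - 1) = 0, with a - 1 = - (d - 1). *)
have hbc : b * c = - (d - 1) ^+ 2.
  by transitivity (a * d - (a * d - b * c)); [ring | rewrite hd da; ring].
have [b0|b0] := eqVneq b 0.
  have d1 : d = 1.
    by apply/eqP; rewrite -subr_eq0 -sqrf_eq0 -oppr_eq0 -hbc b0 mul0r.
  exists (- c), 0, 1; rewrite oner_eq0 orbT; split=> //.
  by rewrite /transvection da d1 b0; congr mx2; ring.
exists b, 1, ((d - 1) / b); rewrite oner_eq0; split=> //.
have -> : c = - (d - 1) ^+ 2 / b by rewrite -hbc; field.
by rewrite /transvection da; congr mx2; field.
Qed.

End SL2Classes.

(** * Values of binary quadratic forms *)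

Section QuadraticForms.
Variable k : fieldType.
Implicit Types (a b c d x y z : k).

Lemma ternary_isotropic a b c d :
  u_le2 k ->
  exists x y z, [|| x != 0, y != 0 | z != 0] /\
    a * x ^+ 2 + b * x * y + c * y ^+ 2 = d * z ^+ 2.
Proof.
move=> hu.
pose X i : {mpoly k[3]} := 'X_i.
have hX i : X i \is 1.-homog by rewrite dhomogX; apply/eqP; exact: mdeg1.
have hXX e i j : e *: (X i * X j) \is 2.-homog.
  by apply: dhomogZ; exact: (dhomogM (hX i) (hX j)).
pose i0 : 'I_3 := inord 0; pose i1 : 'I_3 := inord 1; pose i2 : 'I_3 := inord 2.
pose q := a *: (X i0 * X i0) + b *: (X i0 * X i1) + c *: (X i1 * X i1)
          + (- d) *: (X i2 * X i2).
have hq : q \is 2.-homog by rewrite !dhomogD.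
have [v [i vi]] := hu q hq.
rewrite /q !mevalD !mevalZ !mevalM !mevalXU => h.
exists (v i0), (v i1), (v i2); split.
  have {vi} : v (inord i) != 0 by rewrite inord_val.
  by case: i => [[|[|[|//]]] ?] /= ->; rewrite ?orbT.
by apply/eqP; rewrite -subr_eq0 -h; apply/eqP; ring.
Qed.

(** An isotropic vector with [z != 0] gives the value [d] after division by [z]. Otherwise the
    binary form is itself isotropic, and translating a basis vector along the isotropic line changes
    its value affinely. *)
Lemma binary_universal a b c d :
  u_le2 k -> b ^+ 2 - 4%:R * a * c != 0 -> d != 0 ->
  exists x y, a * x ^+ 2 + b * x * y + c * y ^+ 2 = d.
Proof.
move=> hu disc d0.
have [x [y [z [nz h]]]] := ternary_isotropic a b c d hu.
have [z0|z0] := eqVneq z 0; last first.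
  exists (x / z), (y / z).
  transitivity ((a * x ^+ 2 + b * x * y + c * y ^+ 2) / z ^+ 2); first by field.
  by rewrite h; field.
move: nz h; rewrite z0 eqxx orbF expr0n mulr0 => nz h.
(* [l] and [m] are the coefficients of the polar form at the isotropic [(x, y)]. *)
pose l := 2%:R * a * x + b * y; pose m := b * x + 2%:R * c * y.
have [l0|l0] := eqVneq l 0; last first.
  (* The value at t (x, y) + (1, 0) is t l + a; solve for [d]. *)
  exists ((d - a) / l * x + 1), ((d - a) / l * y).
  transitivity (((d - a) / l) ^+ 2 * (a * x ^+ 2 + b * x * y + c * y ^+ 2)
                + (d - a) / l * l + a); first by rewrite /l; ring.
  by rewrite h; field.
have [m0|m0] := eqVneq m 0; last first.
  exists ((d - c) / m * x), ((d - c) / m * y + 1).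
  transitivity (((d - c) / m) ^+ 2 * (a * x ^+ 2 + b * x * y + c * y ^+ 2)
                + (d - c) / m * m + c); first by rewrite /m; ring.
  by rewrite h; field.
(* If [l = m = 0], then (x, y) lies in the radical of the polar form, which is trivial by [disc]. *)
have hx : (b ^+ 2 - 4%:R * a * c) * x = 0.
  transitivity (b * m - 2%:R * c * l); first by rewrite /l /m; ring.
  by rewrite l0 m0 !mulr0 subr0.
have hy : (b ^+ 2 - 4%:R * a * c) * y = 0.
  transitivity (b * l - 2%:R * a * m); first by rewrite /l /m; ring.
  by rewrite l0 m0 !mulr0 subr0.
move/eqP: hx; move/eqP: hy; rewrite !mulf_eq0 (negbTE disc) /= => /eqP y0 /eqP x0.
by move: nz; rewrite x0 y0 eqxx.
Qed.

(** X (X^2 - d) has at most three roots. *)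
Lemma exists_sqr_neq d :
  (exists2 s : seq k, uniq s & (5 <= size s)%N) ->
  exists2 m, m != 0 & m ^+ 2 != d.
Proof.
case=> s us hs.
pose p : {poly k} := 'X * ('X^2 - d%:P).
have sp : size p = 4%N.
  by rewrite /p mulrC size_mulX ?size_XnsubC // -size_poly_eq0 size_XnsubC.
have p0 : p != 0 by rewrite -size_poly_eq0 sp.
case/boolP: (all (root p) s) => [ha|/allPn[m _]].
  by have := max_poly_roots p0 ha us; rewrite sp ltnNge (ltnW hs).
rewrite /root !hornerE mulf_eq0 negb_or => /andP[m0 md].
by exists m => //; rewrite -subr_eq0.
Qed.

(* The conic [e1 x^2 + e2 y^2 = e1 x0^2] is parametrized by the slopes [m] of the
   lines through [(x0, 0)]; the hypothesis on [e1], [e2] keeps [x] nonzero. *)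
Lemma represents_moving_axis e1 e2 x0 :
  2%:R != 0 :> k -> (exists2 s : seq k, uniq s & (5 <= size s)%N) ->
  e1 != 0 -> e2 != 0 -> ~ same_sqclass e1 e2 -> x0 != 0 ->
  exists x y, [/\ x != 0, y != 0 & e1 * x ^+ 2 + e2 * y ^+ 2 = e1 * x0 ^+ 2].
Proof.
move=> two0 hcard e10 e20 e12 x00.
(* [hm] keeps the denominator e1 + e2 m^2 nonzero, and [m0] keeps [y] nonzero. *)
have [m m0 hm] := exists_sqr_neq (- (e1 / e2)) hcard.
have den0 : e1 + e2 * m ^+ 2 != 0.
  apply: contraNneq hm => h; apply/eqP.
  transitivity ((e1 + e2 * m ^+ 2) / e2 - e1 / e2); first by field.
  by rewrite h mul0r add0r.
have num0 : e1 - e2 * m ^+ 2 != 0.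
  apply/eqP=> h; apply: e12; exists m => //.
  transitivity ((e1 - e2 * m ^+ 2) / e2 + m ^+ 2); first by field.
  by rewrite h mul0r add0r.
(* The second point of the conic on the line y = m (x + x0). *)
exists (x0 * (e1 - e2 * m ^+ 2) / (e1 + e2 * m ^+ 2)),
       (x0 * (2%:R * e1 * m) / (e1 + e2 * m ^+ 2)); split.
- by rewrite !mulf_neq0 ?invr_eq0.
- by rewrite !mulf_neq0 ?invr_eq0.
- by field.
Qed.

(** Universality gives some solution; if it lies on a coordinate axis, it is moved along the
    conic. *)
Lemma represents_off_axes e1 e2 d :
  u_le2 k -> 2%:R != 0 :> k ->
  (exists2 s : seq k, uniq s & (5 <= size s)%N) ->
  e1 != 0 -> e2 != 0 -> ~ same_sqclass e1 e2 -> d != 0 ->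
  exists x y, [/\ x != 0, y != 0 & e1 * x ^+ 2 + e2 * y ^+ 2 = d].
Proof.
move=> hu two0 hcard e10 e20 e12 d0.
have disc : 0 ^+ 2 - 4%:R * e1 * e2 != 0.
  rewrite expr0n sub0r oppr_eq0 !mulf_neq0 //.
  by rewrite (_ : 4%:R = 2%:R * 2%:R) ?mulf_neq0 //; ring.
have [x [y]] := binary_universal hu disc d0; rewrite !mul0r addr0 => h.
have [x0|x0] := eqVneq x 0; have [y0|y0] := eqVneq y 0; last by exists x, y.
- by move: d0; rewrite -h x0 y0 expr0n !mulr0 addr0 eqxx.
- have e21 : ~ same_sqclass e2 e1.
    case=> z z0 hz; apply: e12; exists z^-1; first by rewrite invr_eq0.
    by rewrite exprVn -hz invf_div.
  have [y' [x' [y'0 x'0 h']]] := represents_moving_axis two0 hcard e20 e10 e21 y0.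
  by exists x', y'; split=> //; rewrite addrC h' -h x0 expr0n mulr0 add0r.
- have [x' [y' [x'0 y'0 h']]] := represents_moving_axis two0 hcard e10 e20 e12 x0.
  by exists x', y'; split=> //; rewrite h' -h y0 expr0n mulr0 addr0.
Qed.

End QuadraticForms.

(** * Semisimplicity and centrality read from the trace *)

Section Semisimplicity.

Lemma splitting_sqrt (k : fieldType) (d : k) :
  exists (L : fieldType) (f : {rmorphism k -> L}) (r : L), r ^+ 2 = f d.
Proof.
case: (classic (exists r, r ^+ 2 = d)) => [[r hr]|nsq].
  by exists k, idfun, r.
have irr : irreducible_poly ('X^2 - d%:P).
  apply: cubic_irreducible; first by rewrite size_XnsubC.
  move=> r; rewrite /root !hornerE subr_eq0; apply/eqP=> hr.
  by apply: nsq; exists r.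
have [L _ [r hr _]] := irredp_FAdjoin irr.
exists L, (GRing.in_alg L), r; apply/eqP.
by move: hr; rewrite /root rmorphB /= map_polyXn map_polyC !hornerE subr_eq0.
Qed.

(** By Cayley-Hamilton, checked here on entries, (X - r1) (X - r2) kills A, so the minimal
    polynomial divides a product of distinct linear factors. *)
Lemma diagonalizable_mx2 (L : fieldType) (A : 'M[L]_2) (r1 r2 : L) :
  r1 != r2 -> \tr A = r1 + r2 -> \det A = r1 * r2 -> diagonalizable A.
Proof.
move=> r12; rewrite [A]mx2_eta.
move: (A 0 0) (A 0 1) (A 1 0) (A 1 1) => a b c d.
rewrite tr_mx2 det_mx2 => ht hd.
apply/diagonalizableP; exists [:: r1; r2]; first by rewrite /= inE r12.
apply: mxminpoly_min; rewrite !big_cons big_nil mulr1 rmorphM /=.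
rewrite !rmorphB /= !horner_mx_X !horner_mx_C.
have e : d = r1 + r2 - a by rewrite -ht addrC addKr.
have hbc : b * c = a * d - r1 * r2 by rewrite -hd; ring.
have X r : mx2 a b c d - r%:M = mx2 (a - r) b c (d - r).
  by rewrite [LHS]mx2_eta !mxE /= !subr0.
rewrite !X -[_ * _]/(_ *m _) mx2M.
have Z : (0 : 'M[L]_2) = mx2 0 0 0 0 by rewrite [LHS]mx2_eta !mxE.
by apply: etrans (esym Z); rewrite e in hbc *; congr mx2; ring: hbc.
Qed.

(** The characteristic polynomial X^2 - t X + 1 has discriminant t^2 - 4; a square root [r] of it
    yields the distinct eigenvalues (t + r) / 2 and (t - r) / 2. *)
Lemma semisimple_tr (k : fieldType) (A : 'M[k]_2) :
  2%:R != 0 :> k -> \det A = 1 -> (\tr A) ^+ 2 != 4%:R -> semisimple A.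
Proof.
move=> two0 hd ht.
have [L [f [r hr]]] := splitting_sqrt ((\tr A) ^+ 2 - 4%:R).
exists L, f; set t := f (\tr A).
have L2 : 2%:R != 0 :> L by rewrite -(rmorph_nat f) fmorph_eq0.
have hr' : r ^+ 2 = t ^+ 2 - 4%:R by rewrite hr rmorphB rmorphXn rmorph_nat.
have r0 : r != 0 by rewrite -sqrf_eq0 hr fmorph_eq0 subr_eq0.
apply: (@diagonalizable_mx2 _ _ ((t + r) / 2%:R) ((t - r) / 2%:R)).
- rewrite -subr_eq0 (_ : _ - _ = r) //; by field.
- by rewrite trace_map_mx -/t; field.
- rewrite det_map_mx hd rmorph1.
  have L4 : 4%:R != 0 :> L by rewrite (_ : 4%:R = 2%:R * 2%:R) ?mulf_neq0 //; ring.
  transitivity ((t ^+ 2 - r ^+ 2) / 4%:R); first by rewrite hr'; field.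
  by field; rewrite L2.
Qed.

(** Commuting with the two elementary matrices gives [b = 0] and [d = a], whence a^2 = 1. *)
Lemma central_tr (k : fieldType) (A : 'M[k]_2) :
  central A -> \det A = 1 -> (\tr A) ^+ 2 = 4%:R.
Proof.
rewrite [A]mx2_eta; move: (A 0 0) (A 0 1) (A 1 0) (A 1 1) => a b c d.
move=> cA; rewrite det_mx2 tr_mx2 => hd.
have := cA (mx2 1 1 0 1); have := cA (mx2 1 0 1 1).
rewrite /SL2 !det_mx2 !mx2M !(mul0r, mul1r, mulr0, mulr1, add0r, addr0, subr0).
move=> /(_ erefl)/mx2_inj[+ _ _ _] /(_ erefl)/mx2_inj[h1 h2 _ _].
move/eqP; rewrite -subr_eq0 opprD addNKr oppr_eq0 => /eqP b0.
have da : d = a by apply: (addIr b); rewrite addrC h2 addrC.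
have <- : a * a = 1 by rewrite -hd b0 da mul0r subr0.
by rewrite da; ring.
Qed.

End Semisimplicity.

(** * Semisimple elements as products of two unipotents *)

Section Products.
Variable k : fieldType.

Lemma tr_semisimple_class (C : mxpred k) A :
  2%:R != 0 :> k -> is_class C -> C A -> (\tr A) ^+ 2 != 4%:R ->
  semisimple_class C /\ class_trace C (\tr A).
Proof.
move=> two0 hC CA ht; case: (hC) => A0 A0S hA0.
have A0A : sl2_class A0 A by apply/hA0.
have trC B : C B -> \tr B = \tr A.
  by move=> /hA0/sl2_class_tr ->; rewrite (sl2_class_tr A0A).
have detC B : C B -> \det B = 1 by move=> /hA0/sl2_class_det ->.
split; last by split; [exists A | ].
split=> // B CB; rewrite -(trC B CB) in ht; split.
  exact: semisimple_tr two0 (detC B CB) ht.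
by move=> /central_tr/(_ (detC B CB))/eqP; rewrite (negbTE ht).
Qed.

Lemma semisimple_factor (A : 'M[k]_2) e1 e2 s :
  u_le2 k -> \det A = 1 -> (\tr A) ^+ 2 != 4%:R ->
  e1 != 0 -> e2 != 0 -> s != 0 -> 2%:R - \tr A = e1 * e2 * s ^+ 2 ->
  mul_mxpred (Uclass e1) (Uclass e2) A.
Proof.
move=> hu hd ht e10 e20 s0 hs.
have hd' : A 0 0 * A 1 1 - A 0 1 * A 1 0 = 1 by rewrite -det_mx2 -mx2_eta.
have htr : \tr A = A 0 0 + A 1 1 by rewrite [in LHS](mx2_eta A) tr_mx2.
(* The discriminant of v |-> det (v, A v) is (tr A)^2 - 4 det A. *)
have disc : (A 1 1 - A 0 0) ^+ 2 - 4%:R * A 1 0 * - A 0 1 != 0.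
  rewrite (_ : _ - _ = \tr A ^+ 2 - 4%:R * (A 0 0 * A 1 1 - A 0 1 * A 1 0)).
    by rewrite hd' mulr1 subr_eq0.
  by rewrite htr; ring.
have es0 : - e2 * s ^+ 2 != 0 by rewrite mulf_neq0 ?oppr_eq0 ?expf_neq0.
have [x [y hxy]] := binary_universal hu disc es0.
have xy0 : (x != 0) || (y != 0).
  rewrite -negb_and; apply: contra es0 => /andP[/eqP x0 /eqP y0].
  by rewrite -hxy x0 y0; apply/eqP; ring.
pose Y := transvection (- e1) x y *m A.
have AE : A = transvection e1 x y *m Y.
  by rewrite /Y mulmxA transvection_mul subrr transvection0 mul1mx.
have dY : \det Y = 1 by rewrite det_mulmx det_transvection hd mul1r.
have tY : \tr Y = 2%:R.
  rewrite /Y tr_transvectionN_mul hxy.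
  by transitivity (\tr A + e1 * e2 * s ^+ 2); [ring | rewrite -hs addrC subrK].
have [f [z [w [zw0 YE]]]] := tr2_transvection dY tY.
pose D := x * w - y * z.
(* Computing tr A from the factorization compares [f] with [e2]: they differ by the square of s / D,
   which is then absorbed into the vector (z, w). *)
have hD : e1 * e2 * s ^+ 2 = e1 * f * D ^+ 2.
  by rewrite -hs {1}AE YE tr_transvection_mul subKr.
have hf : f * D ^+ 2 = e2 * s ^+ 2.
  by apply: (mulfI e10); rewrite mulrA -hD -mulrA.
have D0 : D != 0.
  by apply: contraNneq es0 => D0; rewrite mulNr -hf D0 expr0n mulr0 oppr0.
have fE : f = e2 * (s / D) ^+ 2.
  by apply: (mulIf (expf_neq0 2 D0)); rewrite hf; field.
exists (transvection e1 x y), Y; split=> //.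
  by apply/UclassP; exists x, y.
apply/UclassP; exists (s / D * z), (s / D * w); split.
  by rewrite !mulf_eq0 invr_eq0 (negbTE s0) (negbTE D0).
by rewrite YE fE -transvectionM.
Qed.

End Products.

(** * Classes contained in a product of two distinct unipotent classes *)

Theorem proposition3p15 (k : fieldType)
  (hu : u_le2 k)
  (hqc : ~ quadratically_closed k)
  (hchar : 2%N \notin [pchar k])
  (hcard : exists2 s : seq k, uniq s & (5 <= size s)%N)
  (C : mxpred k) (hC : is_class C)
  (e1 e2 : k) (he1 : e1 != 0) (he2 : e2 != 0)
  (he12 : ~ same_sqclass e1 e2) :
  sub_mxpred C (mul_mxpred (Uclass e1) (Uclass e2)) <->
  [\/ semisimple_class C /\
        (exists2 t : k, class_trace C t & in_sqcoset (e1 * e2) (2%:R - t)),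
      unipotent_class C
    | [/\ same_mxpred C (fun A => A = 1%:M),
          ~ unit_square (-1 : k)
        & same_sqclass e2 (- e1)]].
Proof.
have two0 : 2%:R != 0 :> k by move: hchar; rewrite inE.
(* Trace 2 would make e1 e2 s^2 vanish; trace -2 would make it 4, so that e1 / e2 = (2 / (e2 s))^2,
   against [he12]. *)
have tr_neq (A : 'M[k]_2) (s : k) : s != 0 -> 2%:R - \tr A = e1 * e2 * s ^+ 2 ->
    (\tr A) ^+ 2 != 4%:R.
  move=> s0 hs; apply/eqP=> ht.
  have : (2%:R - \tr A) * (2%:R + \tr A) = 0.
    by transitivity (4%:R - \tr A ^+ 2); [ring | rewrite ht subrr].
  move/eqP; rewrite mulf_eq0 hs !mulf_eq0 (negbTE he1) (negbTE he2) (negbTE s0).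
  move=> /= /eqP ht2; apply: he12; exists (2%:R / (e2 * s)).
    by rewrite !mulf_neq0 ?invr_eq0 ?mulf_neq0.
  have h4 : e1 * e2 * s ^+ 2 = 4%:R.
    by rewrite -hs -[RHS]subr0 -ht2; ring.
  transitivity (e1 * e2 * s ^+ 2 / (e2 * s) ^+ 2); first by field; rewrite s0 he2.
  by rewrite h4; field; rewrite s0 he2.
split.
- case: (hC) => A AS CA sub.
  have AinC : C A by apply/CA/sl2_class_refl.
  have [X [Y [/UclassP[x [y [xy ->]]] /UclassP[z [w [zw ->]]] AE]]] := sub A AinC.
  pose D := x * w - y * z.
  have htr : 2%:R - \tr A = e1 * e2 * D ^+ 2.
    by rewrite AE tr_transvection_mul subKr.
  have [D0|D0] := eqVneq D 0; last first.
    have ht := tr_neq A D D0 htr.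
    have [ssC trC] := tr_semisimple_class two0 hC AinC ht.
    constructor 1; split=> //; exists (\tr A) => //.
    by exists (D ^+ 2) => //; exists D.
  (* For D = 0 the two nonzero vectors are parallel, so the factors share an axis and their
     parameters add. *)
  have [c c0 [zE wE]] : exists2 c, c != 0 & z = c * x /\ w = c * y.
    have xw : x * w = y * z by apply/eqP; rewrite -subr_eq0 -/D D0.
    have [x0|x0] := eqVneq x 0.
      have y0 : y != 0 by move: xy; rewrite x0 eqxx.
      have z0 : z = 0.
        by apply/eqP; move/eqP: xw; rewrite x0 mul0r eq_sym mulf_eq0 (negbTE y0).
      have w0 : w != 0 by move: zw; rewrite z0 eqxx.
      exists (w / y); first by rewrite mulf_neq0 ?invr_eq0.
      by rewrite x0 z0 mulr0; split=> //; field.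
    have wE : w = z / x * y.
      by apply: (mulfI x0); rewrite xw; field.
    exists (z / x); last by split=> //; field.
    rewrite mulf_neq0 ?invr_eq0 //; apply: contraTneq zw => z0.
    by rewrite wE z0 !mul0r eqxx.
  move: AE; rewrite zE wE transvectionM transvection_mul => AE.
  have [e0|e0] := eqVneq (e1 + e2 * c ^+ 2) 0; last first.
    constructor 2; exists (e1 + e2 * c ^+ 2) => // B.
    apply: iff_trans (CA B) _; apply: sl2_class_same.
    by apply/UclassP; exists x, y.
  have e1E : e1 = - (e2 * c ^+ 2) by apply/eqP; rewrite -addr_eq0 e0.
  constructor 3; split.
  + move=> B; apply: iff_trans (CA B) _; rewrite AE e0 transvection0; split.
      by case=> g /SL2_unit ug ->; rewrite mulmx1 mulmxV.
    by move=> ->; exact: sl2_class_refl.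
  (* If -1 = i^2, then e1 = - e2 c^2 = e2 (i c)^2. *)
  + case=> i i0 hi; apply: he12; exists (i * c); first by rewrite mulf_neq0.
    by rewrite e1E exprMn -hi; field.
  + exists c^-1; first by rewrite invr_eq0.
    by rewrite e1E opprK; field; rewrite c0 he2.
- case=> [[_ [t [_ trC] [_ [s s0 ->] hs]]] A CA | [e e0 Ce] A /Ce |
            [C1 _ [c c0 hc]] A /C1 ->].
  + rewrite -(trC A CA) in hs.
    have dA : \det A = 1.
      by case: hC => B BS hB; rewrite (sl2_class_det (proj1 (hB A) CA)).
    exact: semisimple_factor hu dA (tr_neq A s s0 hs) he1 he2 s0 hs.
  + case/UclassP=> x [y [xy ->]].
    (* Keep the axis of A and split its parameter as e1 a^2 + e2 b^2; both coefficients must be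
       nonzero for the factors to lie in their classes. *)
    have [a [b [a0 b0 hab]]] := represents_off_axes hu two0 hcard he1 he2 he12 e0.
    exists (transvection e1 (a * x) (a * y)), (transvection e2 (b * x) (b * y)).
    split; last by rewrite !transvectionM transvection_mul hab.
    * apply/UclassP; exists (a * x), (a * y).
      by rewrite !mulf_eq0 (negbTE a0).
    * apply/UclassP; exists (b * x), (b * y).
      by rewrite !mulf_eq0 (negbTE b0).
  (* Since e2 = - e1 c^2, these two transvections along the same axis are mutually inverse. *)
  + exists (transvection e1 c 0), (transvection e2 1 0); split.
    * by apply/UclassP; exists c, 0; split; rewrite ?c0.
    * by apply/UclassP; exists 1, 0; split; rewrite ?oner_eq0.
    * have e2E : e2 = - e1 * c ^+ 2 by rewrite -hc mulrC divfK ?oppr_eq0.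
      rewrite -{1}[c]mulr1 -{1}(mulr0 c) transvectionM transvection_mul e2E.
      by rewrite mulNr subrr transvection0.
Qed.
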